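(* Let $G$ be a multi-block graph with blocks $G_t$, $1\leq t\leq b$. Let $\mathcal{L}$ be the Laplacian-like matrix and $D(G)$ the distance matrix of $G$. If $\det D(G) \neq 0$ and $\operatorname{cof} D(G_t)\neq 0$ for all $1\leq t\leq b$, then $$D(G)^{-1} = - \mathcal{L} + \dfrac{1}{\lambda_G}\mu_G \mu_G^t .$$
   Context: All graphs are finite, simple and connected. A block of a graph is a maximal connected subgraph that has no cut-vertex (of itself). For $m\ge 2$, the complete $m$-partite graph $K_{n_1,\dots,n_m}$ has vertex set partitioned into nonempty parts $V_1,\dots,V_m$ with $|V_i|=n_i$, two vertices being adjacent if and only if they lie in different parts. A connected graph is a multi-block graph if each of its blocks is a complete $m$-partite graph for some $m\ge 2$ (which may depend on the block). $D(G)$ is the distance matrix (entries are graph distances), and $\operatorname{cof} B$ is the sum of all cofactors of a square matrix $B$. For positive integers $n_1,\dots,n_k$ put $\gamma_{n_1,\dots,n_k}=\sum_{i=1}^k n_i\prod_{j\ne i}(n_j-2)$ and $\beta_{n_1,\dots,n_k}=\gamma_{n_1,\dots,n_k}+\prod_{i=1}^k(n_i-2)$; $\beta_{\widehat{n_i}},\gamma_{\widehat{n_i}}$ denote these quantities for the list $n_1,\dots,n_m$ with $n_i$ omitted. Empty products equal $1$. Single block: let $H=K_{n_1,\dots,n_m}$ with $\operatorname{cof} D(H)\ne0$ (equivalently $\gamma_{n_1,\dots,n_m}\neq 0$). Define $\lambda_H=\dfrac{\det D(H)}{\operatorname{cof}D(H)}=\dfrac{\beta_{n_1,\dots,n_m}}{\gamma_{n_1,\dots,n_m}}$;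 the vector $\mu_H$ by $\mu_H(v)=\dfrac{1}{\gamma_{n_1,\dots,n_m}}\prod_{j\ne i}(n_j-2)$ for $v\in V_i$; and the Laplacian-like matrix $\mathcal L(H)=[\mathcal L_{uv}]$ by $$\mathcal{L}_{uv}=\begin{cases} \dfrac{(n_i-1)\beta_{\widehat{n_i}}-2 \gamma_{\widehat{n_i}}}{2 \gamma_{n_1,\dots,n_m}} & u = v\in V_i,\\[2mm] -\dfrac{\beta_{\widehat{n_i}}}{2\gamma_{n_1,\dots,n_m}} & u \neq v,\ u,v \in V_i,\\[2mm] \dfrac{\prod_{l \neq i,j}(n_l - 2)}{\gamma_{n_1,\dots,n_m}} & u \in V_i,\ v\in V_j,\ i\ne j. \end{cases}$$ Multi-block graph $G=(V,E)$ with blocks $G_1,\dots,G_b$, all with $\operatorname{cof} D(G_t)\neq0$: $\lambda_G=\sum_{t=1}^b\lambda_{G_t}$; if $v\in V$ belongs to exactly $k$ blocks, $\mu_G(v)=\sum_{t:\,v\in V(G_t)}\mu_{G_t}(v)-(k-1)$; and $\mathcal L=\sum_{t=1}^b\mathcal L(G_t)$, where each $\mathcal L(G_t)$ is regarded as a $|V|\times|V|$ matrix by putting $0$ in all entries whose row or column is not indexed by a vertex of $G_t$. *)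

(* Defs.v *)
From HB Require Import structures.
From mathcomp Require Import all_boot all_order all_algebra.

Set Implicit Arguments.
Unset Strict Implicit.
Unset Printing Implicit Defensive.

Import GRing.Theory.
Local Open Scope ring_scope.

(* A finite graph is a finType of vertices with an adjacency relation; simple
   graphs are those whose relation is symmetric and irreflexive. *)
Section Graph.
Variables (V : finType) (e : rel V).

(* The graph with no vertex is not connected. *)
Definition connected : bool :=
  (0 < #|V|)%N && [forall x, forall y, connect e x y].

Definition delete_vertex (v : V) : rel {x : V | x != v} :=
  fun x y => e (val x) (val y).

(* For a connected graph: deleting v leaves at least two components.  In
   particular the vertex of the one-vertex graph is not a cut-vertex. *)
Definition cut_vertex (v : V) : bool :=
  [exists x, exists y, ~~ connect (delete_vertex (v := v)) x y].

(* The least length of a path from x to y.  It is less than #|V| when y is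
   reachable from x; otherwise find returns the dummy value #|V|. *)
Definition dist (x y : V) : nat :=
  find (fun n => [exists p : n.-tuple V, path e x p && (last x p == y)])
       (iota 0 #|V|).

Definition dist_mx (R : nzRingType) : 'M[R]_#|V| :=
  \matrix_(i, j) (dist (enum_val i) (enum_val j))%:R.

End Graph.

Definition cof (R : comNzRingType) (n : nat) (B : 'M[R]_n) : R :=
  \sum_i \sum_j cofactor B i j.

(* Subgraphs need not be induced: a vertex set with a set of edges, an edge
   being the unordered pair [set x; y] of its ends. *)
Definition subgraph (T : finType) : finType := ({set T} * {set {set T}})%type.

Section Subgraph.
Variable T : finType.
Implicit Types (e : rel T) (H K : subgraph T).

Definition verts H : {set T} := H.1.
Definition edges H : {set {set T}} := H.2.

Definition subgraph_of e H : bool :=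
  edges H \subset [set [set x; y] | x in verts H, y in verts H & e x y].

Definition sub_adj H : rel {x : T | x \in verts H} :=
  fun x y => [set val x; val y] \in edges H.
Arguments sub_adj : clear implicits.

Definition nonseparable e H : bool :=
  [&& subgraph_of e H, connected (sub_adj H)
    & [forall v, ~~ cut_vertex (sub_adj H) v]].

Definition blocks e : {set subgraph T} :=
  [set H | nonseparable e H &
    [forall K, [&& nonseparable e K, verts H \subset verts K
                 & edges H \subset edges K] ==> (K == H)]].

(* H is the complete multipartite graph whose parts are the members of P, for
   some number m = #|P| >= 2 of parts; partition P _ makes them nonempty. *)
Definition complete_multipartite H (P : {set {set T}}) : Prop :=
  [/\ partition P (verts H), (2 <= #|P|)%N &
      {in verts H &, forall x y,
         ([set x; y] \in edges H) = (pblock P x != pblock P y)}].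

(* A choice of the parts of each block. *)
Definition multi_block e (P : subgraph T -> {set {set T}}) : Prop :=
  forall H, H \in blocks e -> complete_multipartite H (P H).

End Subgraph.
Arguments sub_adj {T} H.

(* The list n_1, ..., n_k is given as a family n restricted to a finite set A
   of indices, so that omitting n_i amounts to replacing A by A :\ i. *)
Section GammaBeta.
Variables (R : realFieldType) (I : finType) (n : I -> nat).

Definition gamma (A : {set I}) : R :=
  \sum_(i in A) (n i)%:R * \prod_(j in A :\ i) ((n j)%:R - 2).

Definition beta (A : {set I}) : R :=
  gamma A + \prod_(i in A) ((n i)%:R - 2).

End GammaBeta.

(* One complete multipartite block: P is its set of parts, pblock P v is the
   part containing v.  The values at vertices outside the block are junk. *)
Section OneBlock.
Variables (R : realFieldType) (T : finType).
Implicit Types (H : subgraph T) (P : {set {set T}}).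

Definition part_size (A : {set T}) : nat := #|A|.

Local Notation gamma := (gamma R part_size).
Local Notation beta := (beta R part_size).

Definition block_lambda H : R :=
  \det (dist_mx (sub_adj H) R) / cof (dist_mx (sub_adj H) R).

Definition block_mu P (v : T) : R :=
  (gamma P)^-1 * \prod_(A in P :\ pblock P v) ((part_size A)%:R - 2).

Definition block_laplacian P (u v : T) : R :=
  let U := pblock P u in
  let W := pblock P v in
  if u == v then
    (((part_size U)%:R - 1) * beta (P :\ U) - 2 * gamma (P :\ U))
      / (2 * gamma P)
  else if U == W then
    - (beta (P :\ U) / (2 * gamma P))
  else
    (\prod_(A in P :\ U :\ W) ((part_size A)%:R - 2)) / gamma P.

End OneBlock.

Section MultiBlock.
Variables (R : realFieldType) (T : finType) (e : rel T).
Variable P : subgraph T -> {set {set T}}.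

Definition lambda : R := \sum_(H in blocks e) block_lambda R H.

Definition num_blocks_at (v : T) : nat :=
  #|[set H in blocks e | v \in verts H]|.

Definition mu : 'cV[R]_#|T| :=
  \col_i let v := enum_val i in
    (\sum_(H in blocks e | v \in verts H) block_mu R (P H) v)
      - ((num_blocks_at v)%:R - 1).

Definition laplacian : 'M[R]_#|T| :=
  \matrix_(i, j) let u := enum_val i in let v := enum_val j in
    \sum_(H in blocks e | (u \in verts H) && (v \in verts H))
      block_laplacian R (P H) u v.

End MultiBlock.

(* Main.v *)
Require Import Defs.
From HB Require Import structures.
From mathcomp Require Import all_boot all_order all_algebra.
From mathcomp Require Import ring.

Set Implicit Arguments.
Unset Strict Implicit.
Unset Printing Implicit Defensive.

Import GRing.Theory.
Local Open Scope ring_scope.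

(** Write D for the distance matrix, 1 for the all-ones column, and L, mu, lambda
    for the Laplacian-like matrix, the vector and the scalar of the graph.  The
    formula follows from
      - D mu = lambda 1,
      - D L = 1 mu^T - I,
      - the entries of mu sum to 1.
    Indeed the first two give D (- L + lambda^-1 mu mu^T) = I as soon as lambda
    is nonzero, and if lambda were 0 then D mu = 0 would force mu = 0, as D is
    invertible, against the third.  No formula for the determinant of D is involved.

    For one complete multipartite block the three identities are direct
    computations ([sum_part_dist_mu], [sum_part_dist_laplacian],
    [sum_block_mu]), because the distance from u to w is
    1 + [u and w are in the same part] - 2 [u = w].  The denominators gamma do not
    vanish: det D(H) gamma = beta cof D(H) ([det_gamma]), and if gamma = 0 this
    forces two parts of size 2, for which D(H) is singular with cof D(H) = 0
    ([gamma_neq0]).  The same identity gives det D(H) / cof D(H) = beta / gamma.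

    To pass from blocks to the graph, let the gate of u in a block H be the vertex
    of H at which every walk from u enters H.  Then
    dist u w = dist u (gate u) + dist (gate u) w for every w in H
    ([dist_gate_in]).  Hence the sum over w in H of dist u w times a column of
    L(H) is the block value taken at the gate, the columns of L(H) having sum 0, and the
    same sum against mu_H is dist u (gate u) + lambda_H.  It remains to add over
    the blocks, which only needs to know how often a vertex v is a gate of u:
    if v is in k blocks, it is the gate in all of them when u = v, and in k - 1
    of them otherwise, the exception being the block through which v is reached
    from u ([num_blocks_gate]).  In summed form ([sum_gate]), for every function F,
      sum over blocks H of F (gate_H u) = F u + sum over v of (k_v - 1) F v.
    Taking F = dist u, F = 1 and F = [. = v] yields the three identities.

    Gates exist because a block cannot be enlarged by an ear: a path that joins two
    vertices of a 2-connected set and has its interior outside the set could be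
    added to it ([biconnected_ear]).  So two distinct vertices of a block are not
    joined by a walk without edges inside the block ([outside_uniq]). *)

(** * Distance in a finite graph *)

Section Distance.
Local Open Scope nat_scope.
Variables (V : finType) (f : rel V).

Definition has_walk x y n : bool :=
  [exists p : n.-tuple V, path f x p && (last x p == y)].

Lemma has_walkP x y p : path f x p -> last x p = y -> has_walk x y (size p).
Proof. by move=> fp lp; apply/existsP; exists (in_tuple p); rewrite /= fp lp eqxx. Qed.

(** A shortest walk repeats no vertex, so its length stays below the dummy value
    that [dist] takes on unreachable pairs. *)
Lemma dist_le x p : path f x p -> dist f x (last x p) <= size p.
Proof.
case/shortenP => q fq uq sub_qp.
have le_qp : size q <= size p.
  by apply: uniq_leq_size sub_qp; case/andP: uq.
apply: leq_trans le_qp.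
have lt_q : size q < #|V| by rewrite -[_.+1]/(size (x :: q)) -(card_uniqP uq) max_card.
rewrite leqNgt; apply/negP => lt_qd.
have := before_find 0 (lt_qd : _ < find (has_walk x _) _).
by rewrite nth_iota // add0n (has_walkP fq).
Qed.

Lemma dist_path x y :
  connect f x y -> exists p, [/\ path f x p, last x p = y & size p = dist f x y].
Proof.
case/connectP => p fp ->; case/shortenP: fp => q fq uq _.
have has_q : has (has_walk x (last x q)) (iota 0 #|V|).
  apply/hasP; exists (size q); last exact: has_walkP.
  by rewrite mem_iota /= add0n -[_.+1]/(size (x :: q)) -(card_uniqP uq) max_card.
have := nth_find 0 has_q; rewrite has_find size_iota in has_q.
rewrite nth_iota // add0n => /existsP[t /andP[ft /eqP lt]].
by exists t; rewrite size_tuple.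
Qed.

Lemma distxx x : dist f x x = 0.
Proof. by apply/eqP; rewrite -leqn0; apply: (@dist_le x [::]). Qed.

Lemma dist_gt0 x y : connect f x y -> x != y -> 0 < dist f x y.
Proof.
move=> /dist_path[[|z p] [_ /= <- <-]] //; by rewrite eqxx.
Qed.

Lemma dist_triangle x y z : connect f x y -> connect f y z ->
  dist f x z <= dist f x y + dist f y z.
Proof.
move=> /dist_path[p [fp lp <-]] /dist_path[q [fq lq <-]].
rewrite -size_cat -lq -lp -last_cat; apply: dist_le.
by rewrite cat_path fp lp.
Qed.

Lemma dist_sym x y : symmetric f -> connect f x y -> dist f x y = dist f y x.
Proof.
move=> f_sym.
have half a b : connect f a b -> dist f b a <= dist f a b.
  move=> /dist_path[p [fp lp <-]].
  have frp : path f b (rev (belast a p)).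
    by rewrite -lp rev_path (eq_path (e' := f)) // => c d; rewrite f_sym.
  have := dist_le frp; rewrite size_rev size_belast.
  suff -> : last b (rev (belast a p)) = a by [].
  rewrite -lp; case: (p) => //= c s; by rewrite rev_cons last_rcons.
move=> cxy; apply/eqP; rewrite eqn_leq !half //.
by rewrite (sym_connect_sym f_sym).
Qed.

Lemma dist_le2 x y : x != y -> f x y || [exists z, f x z && f z y] ->
  dist f x y = (~~ f x y).+1.
Proof.
move=> xy near.
have cxy : connect f x y.
  case/orP: near => [/connect1 // | /existsP[z /andP[fxz fzy]]].
  exact: connect_trans (connect1 fxz) (connect1 fzy).
have d0 := dist_gt0 cxy xy; apply/eqP; rewrite eqn_leq.
have [fxy|nfxy] /= := boolP (f x y).
  by rewrite d0 andbT; apply: (@dist_le x [:: y]); rewrite /= fxy.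
rewrite (negPf nfxy) /= in near; case/existsP: near => z /andP[fxz fzy].
rewrite (@dist_le x [:: z; y]) /= ?fxz ?fzy //.
rewrite ltn_neqAle d0 andbT; apply: contra nfxy => /eqP d1.
have [[|a [|b p]] [fp lp sp]] := dist_path cxy; rewrite -d1 // in sp.
by move: fp lp; rewrite /= andbT => + <-.
Qed.

End Distance.

(** * Biconnected vertex sets *)

Section Nonseparable.
Variable T : finType.
Implicit Types (f g : rel T) (X Y : {set T}) (H : subgraph T).

Definition restrict f X : rel T := [rel x y | [&& x \in X, y \in X & f x y]].

Definition linked f X : bool :=
  [forall x in X, forall y in X, connect (restrict f X) x y].

(** Nonseparability of the graph with vertex set [X] and adjacency [f], expressed
    inside the ambient vertex type instead of on nested subtypes.  Deleting
    some [v] outside [X] changes nothing, so [v] may range over the whole type. *)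
Definition biconnected f X : bool :=
  [&& X != set0, linked f X & [forall v, linked f (X :\ v)]].

Lemma linkedP f X :
  reflect {in X &, forall x y, connect (restrict f X) x y} (linked f X).
Proof.
apply: (iffP 'forall_in_forall_inP) => lX x y; last by move=> xX yX; apply: lX.
by move=> xX yX; apply: lX.
Qed.

Lemma sub_linked f g X :
  {in X &, forall x y, f x y -> g x y} -> linked f X -> linked g X.
Proof.
move=> sfg /linkedP lX; apply/linkedP => x y xX yX.
apply: connect_sub (lX x y xX yX) => a b /and3P[aX bX fab].
by apply/connect1/and3P; split=> //; apply: sfg.
Qed.

Lemma sub_biconnected f g X :
  {in X &, forall x y, f x y -> g x y} -> biconnected f X -> biconnected g X.
Proof.
move=> sfg /and3P[X0 lX /forallP lXv]; apply/and3P; split=> //.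
  exact: sub_linked lX.
apply/forallP => v; apply: sub_linked (lXv v) => x y.
by rewrite !inE => /andP[_ xX] /andP[_ yX]; apply: sfg.
Qed.

Lemma connect_val (U : finType) (p : pred U) (f : rel U) (x y : {x | p x}) :
  connect (fun a b : {x | p x} => f (val a) (val b)) x y =
  connect [rel a b | [&& p a, p b & f a b]] (val x) (val y).
Proof.
apply/idP/idP.
  case/connectP => s fs ->{y}; elim: s x fs => //= a s IHs x /andP[fxa fs].
  apply: connect_trans (IHs _ fs); apply: connect1.
  by rewrite /= fxa (valP x) (valP a).
case/connectP => s; elim: s x => /= [|a s IHs] x.
  by move=> _ /val_inj ->.
case/andP => /and3P[px pa fxa] fs ly.
apply: connect_trans (IHs (exist _ a pa) fs ly).
exact: connect1.
Qed.

Definition edge_rel H : rel T := [rel x y | [set x; y] \in edges H].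

Lemma connect_sub_adj H (x y : {x | x \in verts H}) :
  connect (sub_adj H) x y = connect (restrict (edge_rel H) (verts H)) (val x) (val y).
Proof. exact: (connect_val (p := fun x => x \in verts H) (edge_rel H)). Qed.

Lemma connect_delete H v (x y : {x | x != v}) :
  connect (delete_vertex (sub_adj H) (v := v)) x y =
  connect (restrict (edge_rel H) (verts H :\ val v)) (val (val x)) (val (val y)).
Proof.
rewrite (connect_val (p := fun x => x != v) (sub_adj H)) /=.
pose h : rel T := [rel a b | [&& a != val v, b != val v & edge_rel H a b]].
rewrite (eq_connect (e' := fun a b => h (val a) (val b))); last first.
  by [].
rewrite (connect_val (p := fun x => x \in verts H) h).
apply: eq_connect => a b; rewrite /h /restrict /= !inE.
by case: (a \in _); case: (b \in _); rewrite /= ?andbT ?andbF.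
Qed.

(** The bridge between the subtype formulation of connectedness and cut-vertices
    and reachability inside vertex sets. *)
Lemma nonseparableE e H :
  nonseparable e H = subgraph_of e H && biconnected (edge_rel H) (verts H).
Proof.
rewrite /nonseparable; congr (_ && _); apply/andP/and3P.
  case=> /andP[/card_gt0P[x0 _] /forallP cX] /forallP cut.
  have lX : linked (edge_rel H) (verts H).
    apply/linkedP => x y xX yX.
    by have /forallP/(_ (exist _ y yX)) := cX (exist _ x xX); rewrite connect_sub_adj.
  split=> //; first by apply/set0Pn; exists (val x0); apply: (valP x0).
  apply/forallP => v; have [vX|vX] := boolP (v \in verts H); last first.
    by rewrite (setDidPl _) // disjoint_sym disjoints1.
  apply/linkedP => x y; rewrite !inE => /andP[xv xX] /andP[yv yX].
  pose w := exist _ v vX : {x | x \in verts H}.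
  pose x' := exist (fun z => z != w) (exist _ x xX) xv.
  pose y' := exist (fun z => z != w) (exist _ y yX) yv.
  have := cut w; rewrite negb_exists => /forallP/(_ x').
  by rewrite negb_exists => /forallP/(_ y'); rewrite negbK connect_delete.
case=> /set0Pn[x0 x0X] /linkedP lX /forallP lXv; split.
  apply/andP; split; first by apply/card_gt0P; exists (exist _ x0 x0X).
  apply/forallP => x; apply/forallP => y.
  by rewrite connect_sub_adj; apply: lX; apply: valP.
apply/forallP => v; apply/existsP => -[x /existsP[y]]; apply/negP; rewrite negbK.
rewrite connect_delete; have /linkedP := lXv (val v); apply; rewrite !inE.
  by rewrite (valP (val x)) andbT; apply: (valP x).
by rewrite (valP (val y)) andbT; apply: (valP y).
Qed.

End Nonseparable.

(** * Blocks and gates *)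

Section Blocks.
Variables (T : finType) (e : rel T).
Hypotheses (e_sym : symmetric e) (e_conn : connected e).
Implicit Types (X Y : {set T}) (H K : subgraph T).

Let connect_all a b : connect e a b.
Proof. by case/andP: e_conn => _ /forallP/(_ a)/forallP/(_ b). Qed.

Lemma linkedU X Y z : z \in X -> z \in Y ->
  linked e X -> linked e Y -> linked e (X :|: Y).
Proof.
move=> zX zY /linkedP lX /linkedP lY.
have sub (A : {set T}) : A \subset X :|: Y ->
    subrel (connect (restrict e A)) (connect (restrict e (X :|: Y))).
  move=> sA; apply: connect_sub => a b /and3P[aA bA eab].
  by apply/connect1/and3P; split=> //; apply: (subsetP sA).
have r_sym : connect_sym (restrict e (X :|: Y)).
  apply: sym_connect_sym => a b; rewrite /restrict /= e_sym.
  by case: (a \in _); case: (b \in _).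
have toz a : a \in X :|: Y -> connect (restrict e (X :|: Y)) a z.
  rewrite inE => /orP[aX | aY].
    by apply: (sub X (subsetUl _ _)); apply: lX.
  by apply: (sub Y (subsetUr _ _)); apply: lY.
apply/linkedP => a b /toz az /toz; rewrite r_sym; exact: connect_trans.
Qed.

Lemma linked_path x p : path e x p -> linked e [set a in x :: p].
Proof.
elim: p x => [|y p IHp] x /=.
  move=> _; apply/linkedP => a b; rewrite !inE => /eqP-> /eqP->; exact: connect0.
case/andP => exy /IHp lp.
have -> : [set a in [:: x, y & p]] = [set x; y] :|: [set a in y :: p].
  by apply/setP => a; rewrite !inE; case: (a == x); case: (a == y).
apply: (linkedU (z := y)) => //; rewrite ?inE ?eqxx ?orbT //.
have eyx : e y x by rewrite e_sym.
apply/linkedP => a b; rewrite !inE => /orP[] /eqP-> /orP[] /eqP->;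
  rewrite ?connect0 //; apply/connect1/and3P; rewrite !inE !eqxx ?orbT; split=> //.
Qed.

(** Deleting a vertex of the ear leaves two stubs, each still attached to the part
    of [X] that survives at one of the ends [x], [y]; deleting an end leaves the
    ear attached at the other one. *)
Lemma biconnected_ear X x s y : biconnected e X -> x \in X -> y \in X ->
  uniq (x :: rcons s y) -> path e x (rcons s y) ->
  biconnected e (X :|: [set a in s]).
Proof.
case/and3P => X0 lX /forallP lXv xX yX.
rewrite -rcons_cons rcons_uniq inE negb_or /= => /and3P[/andP[yx ys] xs us] ep.
have [es ey] : path e x s /\ e (last x s) y by move: ep; rewrite rcons_path => /andP.
apply/and3P; split.
- by apply/set0Pn; exists x; rewrite inE xX.
- have -> : X :|: [set a in s] = X :|: [set a in x :: s].
    by apply/setP => a; rewrite !inE; case: eqP => [->|]; rewrite ?xX.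
  by apply: (linkedU (z := x)) => //; [rewrite inE mem_head | exact: linked_path].
apply/forallP => v; have [vs|vs] := boolP (v \in s).
  case/splitPr: vs xs ys us ep es ey => s1 s2.
  rewrite !mem_cat !inE !negb_or cat_uniq /= negb_or.
  case/and3P => xs1 xv xs2 /and3P[ys1 yv ys2].
  case/and3P => us1 /andP[vs1 _] /andP[vs2 us2] + _ _.
  rewrite rcons_cat cat_path /= => /and3P[es1 _ es2].
  have es2' : path e (head y s2) (behead (rcons s2 y)).
    by case: (s2) es2 => //= a s' /andP[].
  (* The stubs are x :: s1, attached at x, and rcons s2 y, attached at y. *)
  have -> : (X :|: [set a in s1 ++ v :: s2]) :\ v =
      (X :\ v :|: [set a in x :: s1]) :|: [set a in rcons s2 y].
    apply/setP => a; rewrite !inE mem_cat mem_rcons !inE.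
    case: (eqVneq a v) => [->|av] /=.
      by rewrite eq_sym (negPf xv) (negPf vs1) eq_sym (negPf yv) (negPf vs2).
    case: (eqVneq a x) => [->|_]; first by rewrite xX.
    by case: (eqVneq a y) => [->|_]; rewrite ?yX //= orbA.
  apply: (linkedU (z := y)); rewrite ?inE ?mem_rcons ?mem_head ?yv ?yX //.
    apply: (linkedU (z := x)); rewrite ?inE ?eqxx ?xv ?xX //.
    exact: linked_path.
  have -> : rcons s2 y = head y s2 :: behead (rcons s2 y) by case: (s2).
  exact: linked_path.
have [-> | xv] := eqVneq v x.
  have -> : (X :|: [set a in s]) :\ x = X :\ x :|: [set a in rcons s y].
    apply/setP => a; rewrite !inE mem_rcons !inE.
    case: (eqVneq a x) => [->|_] /=; first by rewrite eq_sym (negPf yx) (negPf xs).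
    by case: (eqVneq a y) => [->|]; rewrite ?yX.
  apply: (linkedU (z := y)); rewrite ?inE ?mem_rcons ?mem_head ?yX ?yx //.
  have -> : rcons s y = head y s :: behead (rcons s y) by case: (s).
  by apply: linked_path; case: (s) ep => //= a s' /andP[].
have -> : (X :|: [set a in s]) :\ v = X :\ v :|: [set a in x :: s].
  apply/setP => a; rewrite !inE.
  case: (eqVneq a v) => [->|_] /=; first by rewrite (negPf xv) (negPf vs).
  by case: (eqVneq a x) => [->|]; rewrite ?xX.
apply: (linkedU (z := x)); rewrite ?inE ?eqxx 1?eq_sym ?xv ?xX //.
exact: linked_path.
Qed.

Lemma has_first (a : pred T) s : has a s ->
  exists s1 x s2, [/\ s = rcons s1 x ++ s2, a x & ~~ has a s1].
Proof. by case/split_find => x s1 s2 ax nas1; exists s1, x, s2. Qed.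

(** The graph without its edges inside [X]. *)
Definition outside X : rel T :=
  [rel a b | e a b && ~~ ((a \in X) && (b \in X))].

Lemma outside_sym X : connect_sym (outside X).
Proof.
by apply: sym_connect_sym => a b; rewrite /outside /= e_sym [(b \in X) && _]andbC.
Qed.

Lemma path_outside X u p : path e u p -> {in belast u p, forall a, a \notin X} ->
  path (outside X) u p.
Proof.
elim: p u => //= a p IHp u /andP[eua ep] nX.
rewrite {1}/outside /= eua (negPf (nX u (mem_head _ _))) /= IHp // => b bp.
by apply: nX; rewrite inE bp orbT.
Qed.

(** A path from [x] without edges inside [X] has, up to its first return to [X],
    all its interior vertices outside [X].  Adding that ear to [X] would
    contradict maximality, unless the ear has no interior; but then it is an edge
    inside [X]. *)
Lemma outside_uniq X x z : maxset (biconnected e) X -> x \in X -> z \in X ->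
  connect (outside X) x z -> x = z.
Proof.
case/maxsetP => bX maxX xX zX /connectP[p0 op0 ez].
rewrite {}ez in zX *; case/shortenP: op0 zX => p op up _ zX {p0}.
have [// | hasX] : x = last x p \/ has (mem X) p.
  case: (p) zX => [|a q] zX; [by left | right].
  by apply/hasP; exists (last x (a :: q)) => //; apply: (mem_last a q).
have [s1 [y [s2 [pE yX nX]]]] := has_first hasX; move: op up; rewrite pE.
rewrite cat_path => /andP[op _].
rewrite -cat_cons cat_uniq => /and3P[up _ _].
have ep : path e x (rcons s1 y).
  by apply: sub_path op => b c /andP[].
(* Maximality puts the interior s1 of the ear inside X, so s1 is empty. *)
have XE := maxX _ (biconnected_ear bX xX yX up ep) (subsetUl _ _).
have s1_nil : s1 = [::].
  case: (s1) XE nX => // b s' XE.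
  have b_in : b \in X by rewrite -XE !inE eqxx orbT.
  by rewrite /= b_in.
by move: op; rewrite s1_nil /= /outside /= xX (yX : y \in X) andbF.
Qed.

(** Cut a geodesic from [u] to [w] at its first vertex in [X], if any. *)
Lemma outside_or_through X u w :
  connect (outside X) u w \/
  exists x, [/\ x \in X, connect (outside X) u x
             & dist e u w = (dist e u x + dist e x w)%N].
Proof.
have [uX|uX] := boolP (u \in X).
  by right; exists u; rewrite connect0 distxx.
have [p [ep lp sp]] := dist_path (connect_all u w).
have [hasX|nX] := boolP (has (mem X) p).
  right; have [s1 [x [s2 [pE xX nX]]]] := has_first hasX; move: ep lp sp; rewrite pE.
  rewrite cat_path last_cat last_rcons size_cat => /andP[ep1 ep2] lp sp.
  exists x; split=> //.
    apply/connectP; exists (rcons s1 x); last by rewrite last_rcons.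
    apply: path_outside => // a; rewrite belast_rcons inE => /orP[/eqP->//|as1].
    by apply: contra nX => aX; apply/hasP; exists a.
  apply/eqP; rewrite eqn_leq (dist_triangle (connect_all _ _) (connect_all _ _)) /= -sp.
  have := dist_le ep1; have := dist_le ep2; rewrite last_rcons lp.
  by move=> d2 d1; apply: leq_add.
left; apply/connectP; exists p => //; apply: path_outside => // a ap.
have: a \in u :: p by rewrite lastI mem_rcons inE ap orbT.
rewrite inE => /orP[/eqP->//|{}ap]; apply: contra nX => aX.
by apply/hasP; exists a.
Qed.

(** The vertex of [X] where walks from [u] enter [X]; by [outside_uniq] it is unique
    when [X] is the vertex set of a block. *)
Definition gate X u : T := odflt u [pick x in X | connect (outside X) u x].

Lemma gateP X u : X != set0 -> gate X u \in X /\ connect (outside X) u (gate X u).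
Proof.
case/set0Pn => x0 x0X; rewrite /gate; case: pickP => [x /andP[] // | no].
case: (outside_or_through X u x0) => [c | [x [xX c _]]].
  by have := no x0; rewrite x0X c.
by have := no x; rewrite xX c.
Qed.

Section Gate.
Variable X : {set T}.
Hypothesis maxX : maxset (biconnected e) X.

Let X0 : X != set0.
Proof. by have /and3P[] := maxsetp maxX. Qed.

Lemma gate_in u : gate X u \in X.
Proof. by case: (gateP u X0). Qed.

Lemma gate_eq u x : x \in X -> connect (outside X) u x -> gate X u = x.
Proof.
move=> xX cux; have [gX cug] := gateP u X0.
apply: (outside_uniq maxX) => //; apply: connect_trans cux.
by rewrite outside_sym.
Qed.

Lemma gate_id x : x \in X -> gate X x = x.
Proof. by move=> xX; apply: gate_eq. Qed.

(** Vertices with different gates are separated by [X], so a geodesic between them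
    enters [X], and does so at the gate of its origin. *)
Lemma dist_gate u w : gate X u != gate X w ->
  dist e u w = (dist e u (gate X u) + dist e (gate X u) w)%N.
Proof.
move=> guw; case: (outside_or_through X u w) => [c | [x [xX c ->]]].
  case/eqP: guw; apply: gate_eq; first exact: gate_in.
  by apply: connect_trans c _; case: (gateP w X0).
by rewrite (gate_eq xX c).
Qed.

Lemma dist_gate_in u w : w \in X ->
  dist e u w = (dist e u (gate X u) + dist e (gate X u) w)%N.
Proof.
move=> wX; have [guw | ] := eqVneq (gate X u) (gate X w); last exact: dist_gate.
by rewrite guw (gate_id wX) distxx addn0.
Qed.

End Gate.

(** The union of two biconnected sets with two common vertices is biconnected,
    since every deletion leaves a common vertex. *)
Lemma max_common X Y u v : maxset (biconnected e) X -> maxset (biconnected e) Y ->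
  u \in X -> v \in X -> u \in Y -> v \in Y -> u != v -> X = Y.
Proof.
move=> maxX maxY uX vX uY vY uv.
have bXY : biconnected e (X :|: Y).
  have /and3P[X0 lX /forallP lXv] := maxsetp maxX.
  have /and3P[Y0 lY /forallP lYv] := maxsetp maxY.
  apply/and3P; split.
  - by apply/set0Pn; exists u; rewrite inE uX.
  - exact: (linkedU uX uY).
  apply/forallP => w; rewrite setDUl.
  have [->|uw] := eqVneq w u.
    by apply: (linkedU (z := v)); rewrite ?inE 1?eq_sym ?uv.
  by apply: (linkedU (z := u)); rewrite ?inE 1?eq_sym ?uw.
by rewrite -(maxsetsup maxX bXY (subsetUl _ _)) (maxsetsup maxY bXY (subsetUr _ _)).
Qed.

Definition induced X : subgraph T :=
  (X, [set [set x; y] | x in X, y in X & e x y]).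

Lemma edge_pair x y a b : [set x; y] = [set a; b] -> e a b -> e x y.
Proof.
move=> E eab.
have := set21 x y; have := set22 x y; have := set21 a b; have := set22 a b.
rewrite {1 2}E -{1 2}E !inE.
by do 4![case/orP=> /eqP ?]; subst; rewrite // e_sym.
Qed.

Lemma edge_induced X : {in X &, forall x y, edge_rel (induced X) x y = e x y}.
Proof.
move=> x y xX yX; apply/imset2P/idP => [[a b aX] | exy]; last first.
  by exists x y; rewrite ?inE ?yX.
rewrite inE => /andP[bX eab] E; exact: edge_pair E eab.
Qed.

Lemma nonseparable_induced X : biconnected e X -> nonseparable e (induced X).
Proof.
move=> bX; rewrite nonseparableE; apply/andP; split; first exact: subxx.
by apply: sub_biconnected bX => x y xX yX; rewrite edge_induced.
Qed.

Lemma nonseparable_verts H : nonseparable e H -> biconnected e (verts H).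
Proof.
rewrite nonseparableE => /andP[/subsetP sH]; apply: sub_biconnected.
move=> x y _ _ /sH /imset2P[a b _]; rewrite inE => /andP[_ eab] E.
exact: edge_pair E eab.
Qed.

(** Adding edges preserves nonseparability, so a block contains all edges between
    its vertices and is determined by its vertex set. *)
Lemma blocksP H : H \in blocks e <->
  maxset (biconnected e) (verts H) /\ H = induced (verts H).
Proof.
rewrite inE; split.
  case/andP => nH /forallP maxH.
  have sub_ind : edges H \subset edges (induced (verts H)) by case/andP: nH.
  have grow X : biconnected e X -> verts H \subset X -> induced X = H.
    move=> bX sX; apply/eqP; apply: (implyP (maxH (induced X))).
    rewrite nonseparable_induced // sX /=; apply: (subset_trans sub_ind).
    apply/subsetP => E /imset2P[a b aX]; rewrite inE => /andP[bX' eab] ->.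
    by apply/imset2P; exists a b; rewrite ?inE ?eab ?(subsetP sX).
  have bH := nonseparable_verts nH.
  split; last by rewrite grow.
  by apply/maxsetP; split=> // X bX sX; rewrite -(grow X bX sX).
case=> maxH HE; apply/andP; split.
  by rewrite HE; apply: nonseparable_induced; apply: maxsetp maxH.
apply/forallP => K; apply/implyP => /and3P[nK sV sE].
have vK : verts K = verts H := maxsetsup maxH (nonseparable_verts nK) sV.
rewrite [K]surjective_pairing [H]surjective_pairing xpair_eqE.
rewrite -/(verts K) -/(verts H) vK eqxx /= eqEsubset sE andbT.
by case/andP: nK => sK _; rewrite HE /= -vK.
Qed.

Hypothesis e_irr : irreflexive e.

Lemma block_of_edge x y : e x y ->
  exists H, [/\ H \in blocks e, x \in verts H & y \in verts H].
Proof.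
move=> exy; have l2 : linked e [set x; y].
  have -> : [set x; y] = [set a in [:: x; y]] by apply/setP => a; rewrite !inE.
  by apply: linked_path; rewrite /= exy.
have b2 : biconnected e [set x; y].
  apply/and3P; split=> //; first by apply/set0Pn; exists x; rewrite set21.
  apply/forallP => v; have [v2|v2] := boolP (v \in [set x; y]); last first.
    by rewrite (setDidPl _) // disjoint_sym disjoints1.
  have xy : x != y by apply: contraTneq exy => ->; rewrite e_irr.
  have : #|[set x; y] :\ v| == 1%N by rewrite cardsDS ?sub1set // cards2 xy cards1.
  by case/cards1P => w ->; apply/linkedP => a b; rewrite !inE => /eqP-> /eqP->.
have [X maxX sX] := maxset_exists b2.
exists (induced X); split; first by apply/blocksP.
  by apply: (subsetP sX); rewrite set21.
by apply: (subsetP sX); rewrite set22.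
Qed.

Lemma block_eq H K : H \in blocks e -> K \in blocks e -> verts H = verts K -> H = K.
Proof. by move=> /blocksP[_ ->] /blocksP[_ ->] /= ->. Qed.

(** The last edge of a geodesic from [u] to [v] lies in a block.  If [v] were the gate
    of [u] there, the other end of that edge would be farther from [u] than [v]. *)
Lemma gate_neq_exists u v : u != v ->
  exists H, [/\ H \in blocks e, v \in verts H & gate (verts H) u != v].
Proof.
move=> uv.
have [p [ep lp sp]] := dist_path (connect_all u v).
case/lastP: p ep lp sp => [|p w] ep lp sp; first by rewrite -lp eqxx in uv.
rewrite last_rcons in lp; rewrite lp in ep sp.
move: ep; rewrite rcons_path size_rcons in sp * => /andP[ep ev].
have [H [bH wH vH]] := block_of_edge ev.
exists H; split=> //; apply: contraTneq (dist_le ep) => guv.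
have [maxH _] := (blocksP H).1 bH.
by rewrite (dist_gate_in maxH _ wH) guv -sp -ltnNge ltnS leq_addr.
Qed.

(** Let [x] be the gate of [u] in [K], so that [x] precedes [v] on a geodesic from [u].
    If [H] and [K] were distinct they would share only [v], so [K] would connect [x]
    to [v] without edges of [H] and the gate of [x] in [H] would be [v], not that
    of [u].  Then [v] would in turn precede [x] on a geodesic from [u]. *)
Lemma gate_neq_uniq u v H K : H \in blocks e -> K \in blocks e ->
  v \in verts H -> v \in verts K -> gate (verts H) u != v -> gate (verts K) u != v ->
  H = K.
Proof.
move=> bH bK vH vK gH gK; apply: block_eq => //.
have [maxH _] := (blocksP H).1 bH; have [maxK _] := (blocksP K).1 bK.
set x := gate (verts K) u in gK.
have xK : x \in verts K by apply: gate_in.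
apply/eqP; apply: contraT => /eqP HK.
have gxv : gate (verts H) x = v.
  apply: gate_eq => //; have /and3P[_ /linkedP lK _] := maxsetp maxK.
  apply: connect_sub (lK x v xK vK) => a b /and3P[aK bK' eab].
  apply: connect1; rewrite /outside /= eab /=; apply/negP => /andP[aH bH'].
  apply: HK; apply: (max_common maxH maxK aH bH' aK bK').
  by apply: contraTneq eab => ->; rewrite e_irr.
have d1 := dist_gate_in maxK u vK.
have d2 : dist e u x = (dist e u v + dist e v x)%N.
  have d3 : gate (verts H) u != gate (verts H) x by rewrite gxv.
  have := dist_gate maxH (u := x) (w := u); rewrite eq_sym gxv => /(_ gH).
  by rewrite ![dist e x _]dist_sym // ![dist e v u]dist_sym // addnC.
have := dist_gt0 (connect_all x v) gK.
move: d1; rewrite -/x d2 -addnA -{1}[dist e u v]addn0 => /eqP.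
by rewrite eqn_add2l eq_sym addn_eq0 => /andP[_ /eqP->].
Qed.

(** For [v] different from [u], the one block at [v] that does not have [v] as gate is
    the block through which [v] is reached from [u]. *)
Lemma num_blocks_gate u v :
  num_blocks_at e v =
  (#|[set H in blocks e | gate (verts H) u == v]| + (u != v))%N.
Proof.
rewrite /num_blocks_at -(cardsID [set H | gate (verts H) u == v]); congr (_ + _)%N.
  apply: eq_card => H; rewrite !inE; case: (boolP (_ == v)); rewrite ?andbF ?andbT //.
  move=> /eqP gv; case: (boolP (H \in blocks e)) => bH.
    rewrite inE in bH; rewrite bH /= -gv; apply: gate_in.
    by have [] := (blocksP H).1; rewrite ?inE.
  by move: bH; rewrite inE => /negPf ->.
have [<-|uv] := eqVneq u v; last first.
  have [H [bH vH gv]] := gate_neq_exists uv.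
  apply/eqP/cards1P; exists H; apply/setP => K.
  rewrite in_set1 in_setD in_set [K \in [set _ in _ | _]]in_set.
  apply/idP/eqP => [/and3P[gvK bK vK] | ->]; last by rewrite gv bH.
  exact: gate_neq_uniq gvK gv.
apply/eqP; rewrite cards_eq0; apply/eqP/setP => H.
rewrite in_setD in_set [H \in [set _ in _ | _]]in_set [RHS]in_set0.
apply/negP => /and3P[gv bH uH]; case/negP: gv.
by rewrite gate_id //; case: ((blocksP H).1 bH).
Qed.

(** The form in which the block structure enters the algebra: a sum over blocks of
    values at gates becomes a sum over vertices weighted by the number of blocks. *)
Lemma sum_gate (R : realFieldType) (F : T -> R) u :
  \sum_(H in blocks e) F (gate (verts H) u) =
  \sum_v ((num_blocks_at e v)%:R - 1) * F v + F u.
Proof.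
rewrite (partition_big (fun H => gate (verts H) u) xpredT) //=.
rewrite [F u](_ : _ = \sum_v (v == u)%:R * F v).
  rewrite -big_split /=; apply: eq_bigr => v _.
  rewrite (eq_bigr (fun _ => F v)); last by move=> H /andP[_ /eqP->].
  rewrite sumr_const -mulrDl (num_blocks_gate u v) natrD -[LHS]mulr_natl; congr (_ * _).
  rewrite (eq_card (B := [set H in blocks e | gate (verts H) u == v])).
    by rewrite [v == u]eq_sym; case: (u == v); rewrite /= ?mulr0n ?mulr1n ?addr0 ?subrK ?addrK.
  by move=> H; rewrite [RHS]in_set.
rewrite (bigD1 u) //= eqxx mul1r big1 ?addr0 // => v /negPf ->.
by rewrite mul0r.
Qed.

End Blocks.

(** Multiply [B x = c 1] by the adjugate and add up the entries. *)
Lemma det_sum_cof (R : comNzRingType) n (B : 'M[R]_n) (x : 'cV_n) c :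
  B *m x = const_mx c -> \det B * \sum_i x i 0 = c * cof B.
Proof.
move=> Bx; have : \adj B *m (B *m x) = \det B *: x.
  by rewrite mulmxA mul_adj_mx mul_scalar_mx.
rewrite Bx => adjc; rewrite mulr_sumr /cof exchange_big mulr_sumr.
apply: eq_bigr => i _; transitivity ((\det B *: x) i 0); first by rewrite mxE.
rewrite -adjc mxE mulr_sumr; apply: eq_bigr => j _.
by rewrite !mxE mulrC.
Qed.

Lemma sum_enum_val (R : nmodType) (V : finType) (F : V -> R) :
  \sum_(i < #|V|) F (enum_val i) = \sum_x F x.
Proof. by rewrite -big_enum_val; apply: eq_bigl => x; rewrite inE. Qed.

Lemma gammaD1 (R : realFieldType) (I : finType) (n : I -> nat) (A : {set I}) i :
  i \in A -> gamma R n A =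
    (n i)%:R * \prod_(j in A :\ i) ((n j)%:R - 2) + ((n i)%:R - 2) * gamma R n (A :\ i).
Proof.
move=> iA; rewrite /gamma (big_setD1 i iA) /=; congr (_ + _).
rewrite mulr_sumr; apply: eq_bigr => j; rewrite !inE => /andP[ji jA].
rewrite (big_setD1 i) /=; last by rewrite !inE eq_sym ji.
by rewrite mulrCA setDDl setUC -setDDl.
Qed.

(** * One complete multipartite graph *)

Section Parts.
Variables (R : realFieldType) (T : finType) (X : {set T}) (P : {set {set T}}).
Hypothesis partP : partition P X.

Local Notation gamma := (gamma R (@part_size T)).
Local Notation beta := (beta R (@part_size T)).
Local Notation defect A := ((part_size A)%:R - 2 : R).

(** The distance in a complete multipartite graph with parts [P]: 0, 2 or 1 according
    to whether the vertices are equal, distinct in one part, or in two parts.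
    Written as a sum, it reduces multiplication by the distance matrix to a
    total sum, a sum over one part and a single value ([sum_part_dist]). *)
Definition part_dist (u v : T) : R :=
  1 + (pblock P u == pblock P v)%:R - 2 * (u == v)%:R.

Lemma pblockX u : u \in X -> pblock P u \in P.
Proof. by case/and3P: partP => /eqP<- _ _; apply: pblock_mem. Qed.

Lemma mem_pblockX u : u \in X -> u \in pblock P u.
Proof. by case/and3P: partP => /eqP<- _ _; rewrite mem_pblock. Qed.

Lemma pblock_part A u : A \in P -> u \in A -> pblock P u = A.
Proof. by case/and3P: partP => _ trivP _ AP uA; apply: def_pblock. Qed.

Lemma sum_parts (F : {set T} -> T -> R) :
  \sum_(u in X) F (pblock P u) u = \sum_(A in P) \sum_(u in A) F A u.
Proof.
rewrite (set_partition_big P) //; apply: eq_bigr => A AP.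
by apply: eq_bigr => u uA; rewrite (pblock_part AP uA).
Qed.

Lemma sum_part_dist (F : T -> R) u : u \in X ->
  \sum_(w in X) part_dist u w * F w =
  \sum_(w in X) F w + \sum_(w in pblock P u) F w - 2 * F u.
Proof.
move=> uX; under eq_bigr do rewrite mulrBl mulrDl mul1r.
rewrite sumrB big_split /=; congr (_ + _ - _).
  rewrite [RHS](big_setID X) /= [X in _ + X]big1 ?addr0; last first.
    move=> w /setDP[wU]; case/and3P: partP => /eqP <- _ _ /negP[].
    by apply/bigcupP; exists (pblock P u) => //; apply: pblockX.
  rewrite big_mkcond [RHS]big_mkcond /=; apply: eq_bigr => w _; rewrite !inE.
  case: ifP => wX; rewrite ?andbF // andbT.
  have -> : (w \in pblock P u) = (pblock P u == pblock P w).
    apply/idP/eqP => [wU|->]; last exact: mem_pblockX.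
    by rewrite (pblock_part (pblockX uX) wU).
  by case: eqP; rewrite ?mul1r ?mul0r.
rewrite (big_setD1 u) //= eqxx big1 ?addr0 ?mulr1 // => w; rewrite !inE.
by rewrite [u == w]eq_sym => /andP[/negPf -> _]; rewrite mulr0 mul0r.
Qed.

Lemma sum_const_part (A : {set T}) (c : R) : \sum_(w in A) c = (part_size A)%:R * c.
Proof. by rewrite sumr_const mulr_natl. Qed.

(** The vector [block_mu] without its denominator, hence meaningful even before
    gamma is known to be nonzero. *)
Definition part_weight (u : T) : R := \prod_(A in P :\ pblock P u) defect A.

Lemma sum_part_weight : \sum_(u in X) part_weight u = gamma P.
Proof.
rewrite (sum_parts (fun A _ => \prod_(B in P :\ A) defect B)).
by apply: eq_bigr => A AP; rewrite sum_const_part.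
Qed.

Lemma sum_part_dist_weight u : u \in X ->
  \sum_(w in X) part_dist u w * part_weight w = beta P.
Proof.
move=> uX; rewrite sum_part_dist // sum_part_weight.
have UP := pblockX uX; rewrite (eq_bigr (fun _ => part_weight u)); last first.
  by move=> w wU; rewrite /part_weight (pblock_part UP wU).
rewrite sum_const_part /beta (big_setD1 _ UP) /= -/(part_weight u); ring.
Qed.

Lemma sum_part_ind (U : {set T}) : U \in P ->
  \sum_(w in X) (w \in U)%:R = (part_size U)%:R :> R.
Proof.
move=> UP; have sUX : U \subset X.
  by case/and3P: partP => /eqP <- _ _; apply: bigcup_sup.
rewrite (big_setID U) /= (setIidPr sUX) [X in _ + X]big1 ?addr0.
  rewrite (eq_bigr (fun _ => 1)); first by rewrite sum_const_part mulr1.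
  by move=> w ->.
by move=> w; rewrite !inE => /andP[/negPf ->].
Qed.

Lemma sum_part_dist_ind U u : U \in P -> u \in X ->
  \sum_(w in X) part_dist u w * (w \in U)%:R =
  (part_size U)%:R + (u \in U)%:R * defect U.
Proof.
move=> UP uX; rewrite sum_part_dist // sum_part_ind //.
rewrite (eq_bigr (fun _ => (u \in U)%:R)) => [|w wu].
  rewrite sum_const_part; case: (boolP (u \in U)) => uU.
    by rewrite (pblock_part UP uU) mulr1n; ring.
  by rewrite mulr0n; ring.
congr (nat_of_bool _)%:R; apply/idP/idP => [wU | uU].
  by rewrite -(pblock_part UP wU) (pblock_part (pblockX uX) wu) mem_pblockX.
by rewrite -(pblock_part UP uU).
Qed.

Lemma sum_block_mu : gamma P != 0 -> \sum_(u in X) block_mu R P u = 1.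
Proof. by move=> g0; rewrite -mulr_sumr sum_part_weight mulVf. Qed.

Lemma sum_part_dist_mu u : u \in X ->
  \sum_(w in X) part_dist u w * block_mu R P w = beta P / gamma P.
Proof.
move=> uX; rewrite -(sum_part_dist_weight uX) mulr_suml.
by apply: eq_bigr => w _; rewrite /block_mu -/(part_weight w); ring.
Qed.

(** The contribution of the part of [v] to the column sum of [v]; by definition of
    gamma, the other parts contribute its opposite. *)
Lemma sum_laplacian_part v : v \in X -> gamma P != 0 ->
  \sum_(w in pblock P v) block_laplacian R P w v =
  - (gamma (P :\ pblock P v) / gamma P).
Proof.
move=> vX g0; have VP := pblockX vX; have vV := mem_pblockX vX.
rewrite (big_setD1 v) //= {1}/block_laplacian eqxx.
rewrite (eq_bigr (fun _ => - (beta (P :\ pblock P v) / (2 * gamma P)))).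
  rewrite sum_const_part.
  have -> : (part_size (pblock P v :\ v))%:R = (part_size (pblock P v))%:R - 1 :> R.
    by rewrite /part_size (cardsD1 v (pblock P v)) vV natrD addrC addKr.
  by field.
move=> w; rewrite !inE => /andP[wv wV].
by rewrite /block_laplacian (negPf wv) (pblock_part VP wV) eqxx.
Qed.

Lemma sum_laplacian v : v \in X -> gamma P != 0 ->
  \sum_(w in X) block_laplacian R P w v = 0.
Proof.
move=> vX g0; have VP := pblockX vX.
rewrite (set_partition_big P) // (big_setD1 _ VP) /= sum_laplacian_part //.
rewrite {2}/gamma mulr_suml addrC; apply/eqP; rewrite subr_eq0; apply/eqP.
apply: eq_bigr => A; rewrite !inE => /andP[AV AP].
rewrite (eq_bigr (fun _ =>
  (\prod_(B in P :\ A :\ pblock P v) ((part_size B)%:R - 2)) / gamma P)).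
  by rewrite sum_const_part setDDl setUC -setDDl mulrA.
move=> w wA; rewrite /block_laplacian (pblock_part AP wA) (negPf AV).
case: eqP => // wv; case/eqP: AV; rewrite -wv.
by rewrite (pblock_part AP wA).
Qed.

Lemma sum_part_dist_laplacian u v : u \in X -> v \in X -> gamma P != 0 ->
  \sum_(w in X) part_dist u w * block_laplacian R P w v =
  block_mu R P v - (u == v)%:R.
Proof.
move=> uX vX g0; rewrite sum_part_dist // sum_laplacian // add0r.
have UP := pblockX uX; have VP := pblockX vX.
have [UV | UV] := eqVneq (pblock P u) (pblock P v).
  rewrite UV sum_laplacian_part // /block_laplacian /block_mu.
  move: (gammaD1 R (@part_size T) VP) g0; rewrite UV eqxx /beta => gE.
  by case: (u == v); rewrite gE ?mulr0n ?mulr1n => g0; field.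
have uv : u != v by apply: contraNneq UV => ->.
rewrite (eq_bigr (fun _ => block_laplacian R P u v)); last first.
  move=> w wU; have wE := pblock_part UP wU.
  have wv : w != v by apply: contraNneq UV => <-; rewrite wE.
  by rewrite /block_laplacian wE (negPf UV) (negPf uv) (negPf wv).
rewrite (negPf uv) sum_const_part /block_mu /block_laplacian (negPf uv) (negPf UV).
rewrite [X in _ = _ * X - _](big_setD1 (pblock P u)) /=; last by rewrite !inE UV.
rewrite setDDl setUC -setDDl; ring.
Qed.

End Parts.

(** * The determinant of a block *)

Section BlockDeterminant.
Variables (R : realFieldType) (T : finType) (H : subgraph T) (P : {set {set T}}).
Hypothesis multiH : complete_multipartite H P.
Local Notation X := (verts H).
Local Notation gamma := (gamma R (@part_size T)).
Local Notation beta := (beta R (@part_size T)).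
Local Notation D := (dist_mx (sub_adj H) R).

Let partP : partition P X. Proof. by case: multiH. Qed.

Lemma other_part A : exists2 B, B \in P & B != A.
Proof.
case: multiH => _ P2 _; have [AP|AP] := boolP (A \in P); last first.
  have /card_gt0P[B BP] : (0 < #|P|)%N by apply: leq_trans P2.
  by exists B => //; apply: contraNneq AP => <-.
have /card_gt0P[B] : (0 < #|P :\ A|)%N by move: P2; rewrite (cardsD1 A P) AP.
by rewrite !inE => /andP[BA BP]; exists B.
Qed.

Lemma part_witness A : A \in P -> exists2 w, w \in X & pblock P w = A.
Proof.
move=> AP; case/and3P: (partP) => /eqP covP _ P0.
have /set0Pn[w wA] : A != set0 by apply: contraNneq P0 => <-.
exists w; last exact: (pblock_part partP AP wA).
by rewrite -covP; apply/bigcupP; exists A.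
Qed.

(** Serves both for the block itself and for the whole graph as [f], with [x] and [y]
    standing for [u] and [v].  Two vertices of one part are at distance 2 because
    there is another part, whose vertices are adjacent to both. *)
Lemma dist_multipartite (V : finType) (f : rel V) (x y : V) (u v : T) :
  u \in X -> v \in X -> (x == y) = (u == v) ->
  f x y = (pblock P u != pblock P v) ->
  (forall w, w \in X -> pblock P w != pblock P u -> pblock P w != pblock P v ->
     exists2 z, f x z & f z y) ->
  (dist f x y)%:R = part_dist R P u v.
Proof.
move=> uX vX xy fxy mid; rewrite /part_dist.
have [uv|uv] := eqVneq u v.
  have /eqP-> : x == y by rewrite xy uv.
  by rewrite distxx uv eqxx ?mulr1n ?mulr0n; ring.
rewrite dist_le2 ?xy ?uv // fxy; first by case: eqP => _ /=; rewrite ?mulr1n ?mulr0n; ring.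
case: eqP => //= UV; have [A AP AU] := other_part (pblock P u).
have [w wX wA] := part_witness AP.
have [||z fxz fzy] := mid w wX; rewrite ?wA -?UV //.
by apply/existsP; exists z; rewrite fxz.
Qed.

Lemma dist_sub_adj (x y : {x | x \in X}) :
  (dist (sub_adj H) x y)%:R = part_dist R P (val x) (val y).
Proof.
case: multiH => _ _ edgeE.
apply: dist_multipartite; rewrite ?(valP x) ?(valP y) //.
  by apply: edgeE; apply: valP.
move=> w wX wx wy; exists (exist _ w wX); rewrite /sub_adj edgeE ?(valP x) ?(valP y) //.
by rewrite eq_sym.
Qed.

Lemma sum_dist_sub_adj (F : T -> R) i :
  (D *m \col_j F (val (enum_val j))) i 0 =
  \sum_(w in X) part_dist R P (val (enum_val i)) w * F w.
Proof.
rewrite mxE (big_sub (mem X)) -(sum_enum_val (fun x => part_dist _ _ _ (val x) * F (val x))).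
by apply: eq_bigr => j _; rewrite !mxE dist_sub_adj.
Qed.

Lemma det_cof_sum (F : T -> R) c :
  (forall u, u \in X -> \sum_(w in X) part_dist R P u w * F w = c) ->
  \det D * \sum_(w in X) F w = c * cof D.
Proof.
move=> DF; rewrite -(det_sum_cof (x := \col_j F (val (enum_val j)))).
  rewrite (big_sub (mem X)) -sum_enum_val.
  by congr (_ * _); apply: eq_bigr => j _; rewrite mxE.
apply/matrixP => i j; rewrite ord1 sum_dist_sub_adj mxE DF //.
exact: (valP (enum_val i)).
Qed.

(** [det_sum_cof] for the vector of weights, whose image is the constant beta and whose
    sum is gamma. *)
Lemma det_gamma : \det D * gamma P = beta P * cof D.
Proof.
rewrite -(sum_part_weight R partP); apply: det_cof_sum => u uX.
exact: sum_part_dist_weight.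
Qed.

(** If gamma vanishes, so does beta by [det_gamma], hence some part [U] has size 2; what
    remains of gamma then shows that another part [W] has size 2.  The indicators of [U]
    and [W] both have image 2 under the distance matrix, which is therefore
    singular, and then [det_sum_cof] for the indicator of [U] gives cof = 0. *)
Lemma gamma_neq0 : cof D != 0 -> gamma P != 0.
Proof.
move=> cof0; apply/eqP => g0.
have b0 : beta P = 0.
  by apply/eqP; move/eqP: det_gamma; rewrite g0 mulr0 eq_sym mulf_eq0 (negPf cof0) orbF.
have two A : (part_size A)%:R - 2 = 0 :> R -> part_size A = 2.
  by move/eqP; rewrite subr_eq0 Num.Theory.eqr_nat => /eqP.
have /eqP/prodf_eq0[U UP /eqP/two U2] : \prod_(A in P) ((part_size A)%:R - 2) = 0 :> R.
  by move: b0; rewrite /beta g0 add0r.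
have : \prod_(A in P :\ U) ((part_size A)%:R - 2) == 0 :> R.
  by move/eqP: g0; rewrite (gammaD1 _ _ UP) U2 subrr mul0r addr0 mulf_eq0 Num.Theory.pnatr_eq0.
case/prodf_eq0 => W; rewrite !inE => /andP[WU WP] /eqP/two W2.
pose V : finType := {x | x \in X}.
pose ind (A : {set T}) : 'cV[R]_#|V| :=
  \col_j (val (enum_val j) \in A)%:R.
have sum_ind A u : A \in P -> part_size A = 2 -> u \in X ->
    \sum_(w in X) part_dist R P u w * (w \in A)%:R = 2.
  by move=> AP A2 uX; rewrite (sum_part_dist_ind R partP) // A2 subrr mulr0 addr0.
have Dunit : D \in unitmx.
  rewrite unitmxE unitfE; apply: contra cof0 => /eqP det0.
  have := det_cof_sum (fun u => sum_ind U u UP U2).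
  by rewrite det0 mul0r => /esym/eqP; rewrite mulf_eq0 Num.Theory.pnatr_eq0.
have D_ind A : A \in P -> part_size A = 2 -> D *m ind A = const_mx 2.
  move=> AP A2; apply/matrixP => i j; rewrite ord1.
  rewrite (sum_dist_sub_adj (fun w => (w \in A)%:R)) mxE.
  exact: sum_ind (valP (enum_val i)).
have indUW : ind U = ind W.
  by rewrite -[ind U](mulKmx Dunit) -[ind W](mulKmx Dunit) !D_ind.
have [w wX wU] := part_witness UP.
have /matrixP/(_ (enum_rank (exist _ w wX)) 0) := indUW.
rewrite !mxE enum_rankK /= -{1}wU (mem_pblockX partP) //.
case: (boolP (w \in W)) => [wW _ | _ /eqP]; last by rewrite oner_eq0.
by case/eqP: WU; rewrite -wU (pblock_part partP WP wW).
Qed.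

Lemma block_lambdaE : cof D != 0 -> block_lambda R H = beta P / gamma P.
Proof.
move=> cof0; rewrite /block_lambda; apply/eqP.
by rewrite eqr_div ?gamma_neq0 // det_gamma.
Qed.

End BlockDeterminant.

(** * The inverse of the distance matrix *)

Section Inverse.
Variables (R : realFieldType) (T : finType) (e : rel T).
Hypotheses (e_sym : symmetric e) (e_irr : irreflexive e) (e_conn : connected e).
Variable P : subgraph T -> {set {set T}}.
Hypothesis e_multi : multi_block e P.
Hypothesis cofD : forall H : subgraph T, H \in blocks e ->
  cof (dist_mx (sub_adj H) R) != 0.

Local Notation d u v := ((dist e u v)%:R : R).
Local Notation gate_of H u := (gate e (verts H) u).
Local Notation excess v := ((num_blocks_at e v)%:R - 1 : R).

Let gamma_block H : H \in blocks e -> gamma R (@part_size T) (P H) != 0.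
Proof. by move=> bH; apply: (gamma_neq0 (e_multi bH)); apply: cofD. Qed.

Let partition_block H : H \in blocks e -> partition (P H) (verts H).
Proof. by case/e_multi. Qed.

Let gate_block H u : H \in blocks e -> gate_of H u \in verts H.
Proof. by case/(blocksP e_sym) => maxH _; apply: gate_in. Qed.

Lemma dist_block H u v : H \in blocks e -> u \in verts H -> v \in verts H ->
  d u v = part_dist R (P H) u v.
Proof.
move=> bH uH vH; have [_ HE] := (blocksP e_sym H).1 bH.
have adj x y : x \in verts H -> y \in verts H ->
    e x y = (pblock (P H) x != pblock (P H) y).
  move=> xH yH; case: (e_multi bH) => _ _ <- //.
  by rewrite HE -[RHS]/(edge_rel (induced e (verts H)) x y) edge_induced.
apply: (dist_multipartite R (e_multi bH)) => //; first exact: adj.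
by move=> w wH wu wv; exists w; rewrite adj // eq_sym.
Qed.

Lemma sum_dist_block H u (F : T -> R) : H \in blocks e ->
  \sum_(w in verts H) d u w * F w =
  d u (gate_of H u) * \sum_(w in verts H) F w +
  \sum_(w in verts H) part_dist R (P H) (gate_of H u) w * F w.
Proof.
move=> bH; have [maxH _] := (blocksP e_sym H).1 bH.
rewrite mulr_sumr -big_split /=; apply: eq_bigr => w wH.
rewrite (dist_gate_in e_sym e_conn maxH u wH) natrD mulrDl.
by rewrite (dist_block bH (gate_block u bH) wH).
Qed.

Lemma sum_dist_mu H u : H \in blocks e ->
  \sum_(w in verts H) d u w * block_mu R (P H) w =
  d u (gate_of H u) + block_lambda R H.
Proof.
move=> bH; rewrite sum_dist_block // (sum_block_mu (partition_block bH)) ?gamma_block //.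
rewrite mulr1 (block_lambdaE (e_multi bH)) ?cofD //.
by rewrite -(sum_part_dist_mu R (partition_block bH) (gate_block u bH)).
Qed.

Lemma sum_dist_laplacian H u v : H \in blocks e -> v \in verts H ->
  \sum_(w in verts H) d u w * block_laplacian R (P H) w v =
  block_mu R (P H) v - (gate_of H u == v)%:R.
Proof.
move=> bH vH; rewrite sum_dist_block // (sum_laplacian (partition_block bH)) ?gamma_block //.
rewrite mulr0 add0r (sum_part_dist_laplacian (partition_block bH)) ?gate_block //.
exact: gamma_block.
Qed.

Lemma sum_incidence (F : subgraph T -> T -> R) :
  \sum_v \sum_(H in blocks e | v \in verts H) F H v =
  \sum_(H in blocks e) \sum_(v in verts H) F H v.
Proof.
rewrite (exchange_big_dep (mem (blocks e))) /= => [|v H _ /andP[] //].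
by apply: eq_bigr => H bH; apply: eq_bigl => v; rewrite bH.
Qed.

Definition graph_mu (v : T) : R :=
  \sum_(H in blocks e | v \in verts H) block_mu R (P H) v - excess v.

Lemma sum_graph_mu : \sum_v graph_mu v = 1.
Proof.
have [u _] : exists u, u \in T by apply/card_gt0P; case/andP: e_conn.
rewrite sumrB sum_incidence.
rewrite (eq_bigr (fun _ => 1)) => [|H bH]; last first.
  by rewrite (sum_block_mu (partition_block bH)) ?gamma_block.
rewrite (sum_gate e_sym e_conn e_irr (fun _ => 1) u).
by under eq_bigr do rewrite mulr1; rewrite addrC addKr.
Qed.

Lemma sum_dist_graph_mu u : \sum_v d u v * graph_mu v = lambda R e.
Proof.
under eq_bigr do rewrite mulrBr mulr_sumr.
rewrite sumrB (sum_incidence (fun H v => d u v * block_mu R (P H) v)).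
rewrite (eq_bigr (fun H => d u (gate_of H u) + block_lambda R H)) => [|H bH]; last first.
  exact: sum_dist_mu.
rewrite big_split /= (sum_gate e_sym e_conn e_irr (fun v => d u v) u) distxx addr0.
rewrite addrAC (eq_bigr (fun v => d u v * excess v)) => [|v _]; last exact: mulrC.
by rewrite subrr add0r.
Qed.

(** The blocks at [v] contribute [block_mu] minus the indicator of their gate being [v].
    A block without [v] contributes 0, and so does its indicator, which makes
    [sum_gate] applicable to the sum of the indicators over all blocks. *)
Lemma sum_dist_graph_laplacian u v :
  \sum_w d u w * (\sum_(H in blocks e | (w \in verts H) && (v \in verts H))
                    block_laplacian R (P H) w v) =
  graph_mu v - (u == v)%:R.
Proof.
under eq_bigr do rewrite mulr_sumr.
rewrite (eq_bigr (fun w => \sum_(H in blocks e | w \in verts H)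
    if v \in verts H then d u w * block_laplacian R (P H) w v else 0)); last first.
  by move=> w _; rewrite -big_mkcondr; apply: eq_bigl => H; rewrite -andbA.
rewrite (sum_incidence (fun H w =>
  if v \in verts H then d u w * block_laplacian R (P H) w v else 0)).
rewrite (eq_bigr (fun H => (if v \in verts H then block_mu R (P H) v else 0)
                           - (gate_of H u == v)%:R)); last first.
  move=> H bH; case: ifP => vH; first exact: sum_dist_laplacian.
  rewrite big1 // sub0r; case: eqP => [gv | _]; last by rewrite oppr0.
  by rewrite -gv gate_block in vH.
rewrite sumrB -big_mkcondr (sum_gate e_sym e_conn e_irr (fun w => (w == v)%:R) u).
rewrite (bigD1 v) //= eqxx mulr1 [X in excess v + X]big1 ?addr0 => [|w /negPf->]; last first.
  by rewrite mulr0.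
by rewrite opprD addrA.
Qed.

Local Notation D := (dist_mx e R).
Local Notation mu := (mu R e P).
Local Notation one := (const_mx 1 : 'cV[R]_#|T|).

Lemma mulmx_dist_mu : D *m mu = lambda R e *: one.
Proof.
apply/matrixP => i j; rewrite !mxE mulr1 -(sum_dist_graph_mu (enum_val i)).
rewrite -[RHS]sum_enum_val; apply: eq_bigr => k _; by rewrite !mxE.
Qed.

Lemma mulmx_dist_laplacian : D *m laplacian R e P = one *m mu^T - 1%:M.
Proof.
apply/matrixP => i j; rewrite !mxE big_ord1 !mxE mul1r.
rewrite -(inj_eq enum_val_inj) -[RHS]sum_dist_graph_laplacian -[RHS]sum_enum_val.
by apply: eq_bigr => k _; rewrite !mxE.
Qed.

(** Otherwise [mu] would be in the kernel of the distance matrix, but its entries sum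
    to 1. *)
Lemma lambda_neq0 : \det D != 0 -> lambda R e != 0.
Proof.
move=> detD; have Dunit : D \in unitmx by rewrite unitmxE unitfE.
apply/eqP => l0; have mu0 : mu = 0.
  by rewrite -(mulKmx Dunit mu) mulmx_dist_mu l0 scale0r mulmx0.
have := sum_graph_mu; rewrite -sum_enum_val big1 => [/eqP|i _].
  by rewrite eq_sym oner_eq0.
by have /matrixP/(_ i 0) := mu0; rewrite !mxE.
Qed.

End Inverse.

Theorem theorem4p12 (R : realFieldType) (T : finType) (e : rel T)
    (e_sym : symmetric e) (e_irr : irreflexive e) (e_conn : connected e)
    (P : subgraph T -> {set {set T}}) (e_multi : multi_block e P)
    (detD : \det (dist_mx e R) != 0)
    (cofD : forall H : subgraph T, H \in blocks e ->
              cof (dist_mx (sub_adj H) R) != 0) :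
  invmx (dist_mx e R) =
    - laplacian R e P + (1 / lambda R e) *: (mu R e P *m (mu R e P)^T).
Proof.
have Dunit : dist_mx e R \in unitmx by rewrite unitmxE unitfE.
apply: (can_inj (mulKmx Dunit)); rewrite mulmxV // mulmxDr mulmxN.
rewrite mulmx_dist_laplacian // -scalemxAr mulmxA mulmx_dist_mu // -scalemxAl.
rewrite scalerA mul1r mulVf; last exact: lambda_neq0 e_multi cofD detD.
by rewrite scale1r opprB subrK.
Qed.
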